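(* Let $m,n\geq 1$ be integers with $|s_n|\leq m<|s_{n+1}|$ and suppose $m\notin\bigcup_{i=1}^{k}\mathcal{D}_i(n)$, where $\mathcal{D}_1(n)=\{r|s_n| : 1\leq r\leq d_{n+1}\}$, $\mathcal{D}_i(n)=\{|s_n^r s_{n-1}^{d_n}\cdots s_{n+2-i}^{d_{n+3-i}}s_{n+1-i}| : 1\leq r\leq d_{n+1}\}$ for $2\leq i\leq k-1$, and $\mathcal{D}_k(n)=\{|s_n^r s_{n-1}^{d_n}\cdots s_{n+2-k}^{d_{n+3-k}}s_{n+1-k}| : 1\leq r\leq d_{n+1}-1\}$. Then $p(m;l)=0$ for all integers $l\geq 2$, i.e., there is no word $w$ of length $m$ such that $w^l$ is a factor of $\mathbf{s}$.
   Context: Fix $k\geq 2$ and the alphabet $\mathcal{A}_k=\{a_1,\dots,a_k\}$. An infinite word $\mathbf{t}$ is standard episturmian with directive word $x_1x_2x_3\cdots$ ($x_i$ letters) if its palindromic prefixes $u_1=\varepsilon,u_2,\dots$ satisfy $u_{n+1}=(u_nx_n)^{(+)}$, where $w^{(+)}$ is the shortest palindrome having $w$ as a prefix, and $\mathbf{t}=\lim_n u_n$. Let $(d_i)_{i\geq1}$ be positive integers and let $\mathbf{s}$ be the standard episturmian word with directive word $a_1^{d_1}a_2^{d_2}\cdots a_k^{d_k}a_1^{d_{k+1}}a_2^{d_{k+2}}\cdots a_k^{d_{2k}}a_1^{d_{2k+1}}\cdots$. Define words $s_{1-k}=a_2, s_{2-k}=a_3,\dots,s_{-1}=a_k, s_0=a_1$;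 $s_n=s_{n-1}^{d_n}s_{n-2}^{d_{n-1}}\cdots s_0^{d_1}a_{n+1}$ for $1\leq n\leq k-1$; and $s_n=s_{n-1}^{d_n}s_{n-2}^{d_{n-1}}\cdots s_{n-k+1}^{d_{n-k+2}}s_{n-k}$ for $n\geq k$. For integers $m\geq 1$, $l\geq2$, $p(m;l)$ denotes the number of words $w$ over $\mathcal{A}_k$ with $|w|=m$ such that $w^l=ww\cdots w$ ($l$ times) is a factor of $\mathbf{s}$. *)

(* Defs.v *)
From mathcomp Require Import all_boot all_order all_algebra.
From mathcomp Require Import boolp.

Set Implicit Arguments.
Unset Strict Implicit.
Unset Printing Implicit Defensive.

Import GRing.Theory.

Definition wpow (T : Type) (w : seq T) (l : nat) : seq T := flatten (nseq l w).

(* Infinite words are functions on nat, so positions are numbered from 0. *)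
Definition is_factor (T : Type) (w : seq T) (t : nat -> T) : Prop :=
  exists i, w = [seq t (i + j) | j <- iota 0 (size w)].

Definition palindrome (T : Type) (w : seq T) : Prop := rev w = w.

Definition is_pal_closure (T : eqType) (w v : seq T) : Prop :=
  [/\ palindrome v, prefix w v
    & forall v', palindrome v' -> prefix w v' -> size v <= size v'].

Definition word_limit (T : Type) (u : nat -> seq T) (t : nat -> T) : Prop :=
  forall N, exists n0, forall n, n0 <= n ->
    N <= size (u n) /\ take N (u n) = mkseq t N.

(* The palindromic prefix u_(n+1) is [u n] and the letter x_(n+1) is [x n].
   That the [u n] are all the palindromic prefixes of [t], in increasing order
   of length, is [standard_episturmian_palindromes] below. *)
Definition standard_episturmian (T : eqType) (x t : nat -> T) : Prop :=
  exists u : nat -> seq T,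
    [/\ u 0 = [::],
        forall n, is_pal_closure (rcons (u n) (x n)) (u n.+1),
        forall n, palindrome (u n) /\ u n = mkseq t (size (u n))
      & word_limit u t].

Section Words.

Variables (k : nat) (hk : 1 < k) (d : nat -> nat).

(* The letter a_(i+1); the index is read modulo k, so that
   [letter k] = a_(k+1) is a_1 again. *)
Definition letter (i : nat) : 'I_k := Ordinal (ltn_pmod i (ltnW hk)).

(* a_1^(d_1) a_2^(d_2) ... ; position i lies in one of the first i+1 blocks
   because every d_j with j >= 1 is positive. *)
Definition directive (i : nat) : 'I_k :=
  nth (letter 0) (flatten [seq nseq (d j) (letter j.-1) | j <- iota 1 i.+1]) i.

(* d_j extended by 0 to all j <= 0; the value [d 0] is never used. *)
Definition dz (j : int) : nat :=
  match j with Posz j'.+1 => d j'.+1 | _ => 0 end.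

(* [s_list n] is [:: s_n; s_(n-1); ...; s_0]. *)
Fixpoint s_list (n : nat) : seq (seq 'I_k) :=
  match n with
  | 0 => [:: [:: letter 0]]
  | n'.+1 =>
      let p := s_list n' in
      (flatten [seq wpow (nth [::] p j) (d (n'.+1 - j))
               | j <- iota 0 (minn n'.+1 k.-1)]
       ++ (if n'.+1 < k then [:: letter n'.+1] else nth [::] p k.-1)) :: p
  end.

(* s_n for all n >= 1 - k; [Negz j] is -(j+1) and s_(-(j+1)) = a_(k-j).
   The equations defining these words are [sword_neg], [sword0],
   [sword_small] and [sword_large] below. *)
Definition sword (n : int) : seq 'I_k :=
  match n with
  | Posz n' => head [::] (s_list n')
  | Negz j => [:: letter (k - j.+1)]
  end.

(* s_(n-1)^(d_n) s_(n-2)^(d_(n-1)) ... s_(n-c)^(d_(n-c+1)) *)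
Definition sprod (n c : nat) : seq 'I_k :=
  flatten [seq wpow (sword (n%:Z - j%:Z)%R) (dz (n%:Z + 1 - j%:Z)%R)
          | j <- iota 1 c].

(* The set D_i(n), 1 <= i <= k. *)
Definition Dset (i n : nat) : seq nat :=
  let len r := size (wpow (sword n) r ++ sprod n (i - 2)
                     ++ sword (n%:Z + 1 - i%:Z)%R) in
  if i == 1 then [seq r * size (sword n) | r <- iota 1 (d n.+1)]
  else if i < k then [seq len r | r <- iota 1 (d n.+1)]
  else [seq len r | r <- iota 1 (d n.+1 - 1)].

(* p(m;l) *)
Definition num_powers (t : nat -> 'I_k) (m l : nat) : nat :=
  #|[set w : m.-tuple 'I_k | `[< is_factor (wpow w l) t >]]|.

Lemma nth_s_list n j : j <= n -> nth [::] (s_list n) j = sword (n - j)%N.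
Proof.
elim: n j => [|n IHn] [|j] //= le_jn.
by rewrite subSS IHn.
Qed.

Lemma swordS n :
  sword n.+1 =
    flatten [seq wpow (nth [::] (s_list n) j) (d (n.+1 - j))
            | j <- iota 0 (minn n.+1 k.-1)]
    ++ (if n.+1 < k then [:: letter n.+1] else nth [::] (s_list n) k.-1).
Proof. by []. Qed.

Lemma sword_neg j : 0 < j < k -> sword (j%:Z - k%:Z)%R = [:: letter j].
Proof.
case/andP=> j0 jk.
have -> : (j%:Z - k%:Z)%R = Negz (k - j).-1.
  by rewrite NegzE prednK ?subn_gt0 // -subzn ?(ltnW jk) // opprB.
by rewrite /= prednK ?subn_gt0 // subKn // ltnW.
Qed.

Lemma sword0 : sword 0 = [:: letter 0].
Proof. by []. Qed.

Lemma sprodE n c : c <= n ->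
  sprod n c = flatten [seq wpow (sword (n - j.+1)%N) (d (n - j))
                      | j <- iota 0 c].
Proof.
move=> le_cn; rewrite /sprod -[1]addn0 iotaDl -map_comp; congr flatten.
apply/eq_in_map => j; rewrite mem_iota add0n => /andP[_ jc] /=.
have jn : j < n by apply: leq_trans jc le_cn.
rewrite subzn // -[(n%:Z + 1)%R]/(Posz (n + 1)) addn1 subzn ?ltnS 1?ltnW //.
by rewrite add1n subSS -[n - j]prednK ?subn_gt0.
Qed.

Lemma sword_small n : 1 <= n <= k - 1 ->
  sword n = sprod n n ++ [:: letter n].
Proof.
case: n => // n /andP[_ le_nk]; rewrite sprodE // swordS.
have lt_nk : n.+1 < k by rewrite -(prednK (ltnW hk)) ltnS -subn1.
have -> : minn n.+1 k.-1 = n.+1 by apply/minn_idPl; rewrite -subn1.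
rewrite lt_nk; congr (flatten _ ++ _).
apply/eq_in_map => j; rewrite mem_iota add0n => /andP[_ jn] /=.
by rewrite nth_s_list // subSS.
Qed.

Lemma sword_large n : k <= n ->
  sword n = sprod n (k - 1) ++ sword (n%:Z - k%:Z)%R.
Proof.
case: n => [|n] le_kn; first by have := leq_trans hk le_kn.
have k0 : 0 < k by apply: ltnW.
rewrite sprodE; last by apply: leq_trans le_kn; rewrite leq_subr.
have le_kn1 : k.-1 <= n by rewrite -ltnS prednK.
have eqm : minn n.+1 k.-1 = k.-1 by apply/minn_idPr; rewrite (leq_trans le_kn1).
rewrite swordS ltnNge le_kn eqm subn1.
rewrite subzn // nth_s_list // -[in (n.+1 - k)](prednK k0) subSS.
congr (flatten _ ++ _); apply/eq_in_map => j.
rewrite mem_iota add0n => /andP[_ jk] /=.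
by rewrite nth_s_list ?subSS // ltnW // (leq_trans jk).
Qed.

End Words.

Section Episturmian.

Variable T : eqType.

Lemma pal_closure_exists (w : seq T) : exists v, is_pal_closure w v.
Proof.
pose P n := `[< exists v, [/\ palindrome v, prefix w v & size v = n] >].
have exP : exists n, P n.
  exists (size (w ++ rev w)); apply/asboolP; exists (w ++ rev w).
  by rewrite /palindrome rev_cat revK prefix_prefix.
case: (ex_minnP exP) => n /asboolP[v [pv wv <-]] minv.
exists v; split=> // v' pv' wv'; apply: minv; apply/asboolP.
by exists v'.
Qed.

Lemma standard_episturmian_exists (x : nat -> T) :
  exists t, standard_episturmian x t.
Proof.
pose cl w : seq T := projT1 (cid (pal_closure_exists w)).
have clP w : is_pal_closure w (cl w) by rewrite /cl; case: cid.
pose u := fix u n := if n is m.+1 then cl (rcons (u m) (x m)) else [::].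
have uS n : is_pal_closure (rcons (u n) (x n)) (u n.+1) by apply: clP.
have preS n : prefix (u n) (u n.+1).
  have [_ pu _] := uS n; apply: prefix_trans pu.
  by rewrite prefix_rcons.
have pre m n : m <= n -> prefix (u m) (u n).
  elim: n => [|n IHn]; first by rewrite leqn0 => /eqP->; apply: prefix_refl.
  rewrite leq_eqVlt => /predU1P[->|/IHn h]; first exact: prefix_refl.
  exact: prefix_trans h (preS n).
have szu n : n <= size (u n).
  elim: n => // n IHn; have [_ /size_prefix pu _] := uS n.
  by apply: leq_trans pu; rewrite size_rcons.
pose t i := nth (x 0) (u i.+1) i.
have tu n i : i < size (u n) -> nth (x 0) (u n) i = t i.
  move=> lin; rewrite /t.
  case: (leqP n i.+1) => [/pre|/ltnW/pre] /prefixP[v ->].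
    by rewrite nth_cat lin.
  by rewrite nth_cat szu.
have takeu n N : N <= size (u n) -> take N (u n) = mkseq t N.
  move=> leN; apply: (@eq_from_nth _ (x 0)).
    by rewrite size_mkseq size_takel.
  move=> i; rewrite size_takel // => iN.
  by rewrite nth_take // nth_mkseq // tu // (leq_trans iN).
exists t, u; split=> //.
- move=> n; split; last by rewrite -(takeu n) // take_size.
  by case: n => // n; have [] := uS n.
- move=> N; exists N => n leNn; have le := leq_trans leNn (szu n).
  by split=> //; apply: takeu.
Qed.

Lemma standard_episturmian_palindromes (x t : nat -> T) (u : nat -> seq T) :
  u 0 = [::] ->
  (forall n, is_pal_closure (rcons (u n) (x n)) (u n.+1)) ->
  (forall n, u n = mkseq t (size (u n))) ->
  (forall n, size (u n) < size (u n.+1)) /\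
  (forall N, palindrome (mkseq t N) -> exists n, mkseq t N = u n).
Proof.
move=> u0 uS ut.
have szS n : size (u n) < size (u n.+1).
  by have [_ /size_prefix + _] := uS n; rewrite size_rcons.
have szu n : n <= size (u n).
  by elim: n => // n IHn; apply: leq_ltn_trans (szS n).
have tpre a b : a <= b -> prefix (mkseq t a) (mkseq t b).
  move=> ab; rewrite /mkseq -(subnKC ab) iotaD map_cat; exact: prefix_prefix.
split=> // N pN.
have exn : exists n, N <= size (u n) by exists N.
case: (ex_minnP exn) => -[|n] leN minn.
  by exists 0; rewrite u0 in leN *; move: leN; rewrite leqn0 => /eqP->.
exists n.+1; have ltN : size (u n) < N.
  by rewrite ltnNge; apply/negP => /minn; rewrite ltnn.
have [_ pu min] := uS n.
have eqr : rcons (u n) (x n) = mkseq t (size (u n)).+1.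
  have := pu; rewrite prefixE size_rcons => /eqP <-.
  rewrite [u n.+1 in LHS]ut /mkseq -map_take take_iota.
  by rewrite (minn_idPl (szS n)).
suff -> : N = size (u n.+1) by rewrite -ut.
apply/eqP; rewrite eqn_leq leN /=.
by have := min _ pN; rewrite size_mkseq; apply; rewrite eqr tpre.
Qed.

End Episturmian.

(* Main.v *)
(* Write psi_c for the substitution c -> c, b -> cb (b <> c). By Justin's
   formula the standard episturmian word t with directive word x_0 x_1 ... is
   psi_(x_0)(t'), where t' is directed by x_1 x_2 .... A power w^l of s, l >= 2,
   is extended to a left-maximal repeat at distance |w| and desubstituted, one
   directive letter at a time, until the two occurrences in the J-th word t_J
   are empty and followed by distinct letters. Then |w| is the length of
   Psi_J(y), where Psi_J = psi_(x_0) ... psi_(x_(J-1)) and y is the factor of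
   t_J between the two occurrences, and |w| is at most the length of the
   palindromic prefix u_J of s directed by x_0 ... x_(J-1). Every letter of t_J
   other than c = x_J is isolated, so y is a power of c, a single letter, or a
   non-constant word of length at least 3. In the n-th block of the directive
   word Psi_J maps a letter to s_n or to s_n^q s_(n-1)^(d_n) ... s_(n+1-i), as
   in the definition of D_i(n), while u_J is shorter than s_n^(q+2): this
   excludes the third case, and in the other two |Psi_J(y)| lies in some
   D_i(n). *)

Require Import Defs.
From mathcomp Require Import all_boot all_order all_algebra.
From mathcomp Require Import zify.
From mathcomp Require boolp.

Set Implicit Arguments.
Unset Strict Implicit.
Unset Printing Implicit Defensive.

(** * The substitutions psi and palindromic closure *)

Section Psi.

Variables (T : eqType) (a : T).
Implicit Types (b c : T) (v w p : seq T).

Definition psi w : seq T :=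
  flatten [seq if b == a then [:: a] else [:: a; b] | b <- w].

Definition psi_pal w : seq T := rcons (psi w) a.

Lemma psi_cons b w :
  psi (b :: w) = if b == a then a :: psi w else a :: b :: psi w.
Proof. by rewrite /psi /=; case: eqP. Qed.

Lemma psi_cat v w : psi (v ++ w) = psi v ++ psi w.
Proof. by rewrite /psi map_cat flatten_cat. Qed.

Lemma psi_subseq v w : subseq v w -> subseq (psi v) (psi w).
Proof.
elim: w v => [|c w IHw] [|b v] /=; rewrite ?sub0seq //.
case: eqP => [-> /IHw sub_vw|_ /IHw sub_bvw].
  by rewrite !psi_cons; case: (c == a); rewrite /= !eqxx.
rewrite [psi (c :: w)]psi_cons; apply: subseq_trans sub_bvw _.
case: (c == a); first exact: subseq_cons.
exact: (suffix_subseq [:: a; c]).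
Qed.

Lemma subseq_psi w : subseq w (psi w).
Proof.
elim: w => // b w IHw; rewrite psi_cons; case: eqP => [->|_] /=.
  by rewrite eqxx.
by case: eqP; rewrite ?eqxx // => _; apply: subseq_trans IHw (subseq_cons _ _).
Qed.

Lemma psi_pal_cons b w :
  psi_pal (b :: w) = if b == a then a :: psi_pal w else a :: b :: psi_pal w.
Proof. by rewrite /psi_pal psi_cons; case: eqP. Qed.

Lemma psi_pal_cat v w : psi_pal (v ++ w) = psi v ++ psi_pal w.
Proof. by rewrite /psi_pal psi_cat rcons_cat. Qed.

Lemma psi_pal_rev w : psi_pal (rev w) = rev (psi_pal w).
Proof.
elim: w => // b w IHw.
have psi_rev_cat s : psi (rev w) ++ a :: s = rev (psi_pal w) ++ s.
  by rewrite -IHw -cat_rcons.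
rewrite rev_cons -cats1 psi_pal_cat !psi_pal_cons.
by case: eqP => _; rewrite psi_rev_cat !rev_cons -!cats1 -?catA.
Qed.

Lemma psi_palE w : psi_pal w = a :: rev (psi (rev w)).
Proof. by rewrite -[LHS]revK -psi_pal_rev rev_rcons. Qed.

Lemma prefix_psi_pal w b p :
  prefix (rcons (psi_pal w) b) (psi_pal p) = prefix (rcons w b) p.
Proof.
elim: w p => [|c w IHw] [|e p]; rewrite -?[psi_pal [::]]/[:: a].
- by rewrite /= andbF.
- rewrite psi_pal_cons [psi_pal p]psi_palE.
  by case: (eqVneq e a) => [->|_] /=; rewrite eqxx !prefix0s.
- by rewrite psi_pal_cons [psi_pal w]psi_palE; case: ifP; rewrite /= andbF.
rewrite !psi_pal_cons rcons_cons prefix_cons.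
have [->|nca] := eqVneq c a; have [ea|nea] := eqVneq e a.
- by rewrite rcons_cons prefix_cons eqxx IHw.
- by rewrite psi_palE /= eqxx eq_sym (negbTE nea).
- by rewrite [psi_pal p]psi_palE /= eqxx ea (negbTE nca).
- by rewrite !rcons_cons !prefix_cons eqxx IHw.
Qed.

Lemma psi_pal_inj : injective psi_pal.
Proof.
have prefix_of_eq v w : psi_pal v = psi_pal w -> prefix v w.
  case/lastP: v => [|v b] eq_vw; first exact: prefix0s.
  by rewrite -prefix_psi_pal -eq_vw prefix_psi_pal prefix_refl.
move=> v w eq_vw; apply: subseq_anti.
by rewrite !infixW // prefixW // prefix_of_eq.
Qed.

Definition separated : pred (seq T) := sorted [rel b c | (b == a) || (c == a)].

Lemma psi_pal_separated w : separated (psi_pal w).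
Proof.
elim: w => // b w; rewrite psi_pal_cons psi_palE /separated /=.
by case: eqP => _ /= ->; rewrite eqxx ?orbT.
Qed.

Lemma psi_pal_surj p : separated p -> p != [::] -> head a p = a ->
  last a p = a -> exists w, p = psi_pal w.
Proof.
have [n] := ubnP (size p); elim: n p => // n IHn [|b [|c p]] //= size_p.
  by move=> _ _ -> _; exists [::].
case/andP=> _ sep_cp _ -> last_cp.
have [ca|nca] := eqVneq c a.
  have [w ->] := IHn (c :: p) size_p sep_cp isT ca last_cp.
  by exists (a :: w); rewrite psi_pal_cons eqxx.
case: p size_p sep_cp last_cp => [_ _ /eqP|e p size_p].
  by rewrite (negbTE nca).
case/andP=> sep_ce sep_ep last_ep.
have ea : e = a by move: sep_ce; rewrite /= (negbTE nca) => /eqP.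
have [w ->] := IHn (e :: p) (ltnW size_p) sep_ep isT ea last_ep.
by exists (c :: w); rewrite psi_pal_cons (negbTE nca).
Qed.

End Psi.

Section Palindromes.

Variable T : eqType.
Implicit Types (v w p q : seq T).

Lemma palindrome_tail w p : palindrome p -> prefix w p ->
  size p <= 2 * size w -> p = w ++ rev (take (size p - size w) w).
Proof.
move=> + wp; case/prefixP: wp => z ->.
rewrite /palindrome size_cat addKn => pal_wz size_z.
congr (_ ++ _); rewrite -[z in LHS]revK; congr rev.
have := congr1 (take (size z)) pal_wz.
by rewrite rev_cat take_size_cat ?size_rev // => ->; rewrite takel_cat //; lia.
Qed.

Lemma subseq_palindromes w p q : palindrome p -> palindrome q ->
  prefix w p -> prefix w q -> size p <= 2 * size w -> size p <= size q ->
  subseq p q.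
Proof.
move=> pal_p pal_q wp wq size_p.
rewrite [p in subseq p _](palindrome_tail pal_p wp size_p).
case/prefixP: wq pal_q => z -> pal_wz; rewrite size_cat => le_pz.
have := congr1 (take (size p - size w)) pal_wz.
rewrite rev_cat !takel_cat ?size_rev; [move=> <-|lia|lia].
by rewrite subseq_cat2l -subseq_rev revK take_subseq.
Qed.

Lemma sorted_palindrome (r : rel T) w p : symmetric r -> palindrome p ->
  prefix w p -> size p < 2 * size w -> sorted r w -> sorted r p.
Proof.
move=> r_sym pal_p wp lt_p sorted_w.
case: p pal_p wp lt_p => // x0 p'; move: (x0 :: p') => {}p pal_p wp lt_p.
have nth_w i : i < size w -> nth x0 p i = nth x0 w i.
  by move=> lt_i; case/prefixP: wp => z ->; rewrite nth_cat lt_i.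
have nth_mirror i : i < size p -> nth x0 p i = nth x0 p (size p - i.+1).
  by move=> lt_i; rewrite -{1}pal_p nth_rev.
move/(sortedP x0): sorted_w => sorted_w; apply/(sortedP x0) => i lt_i.
have [lt_iw|le_wi] := ltnP i.+1 (size w).
  by rewrite !nth_w ?(ltnW lt_iw) ?sorted_w.
rewrite nth_mirror ?(ltnW lt_i) // (nth_mirror i.+1) // r_sym.
have -> : size p - i.+1 = (size p - i.+2).+1 by lia.
have lt_w : (size p - i.+2).+1 < size w by lia.
by rewrite !nth_w ?(ltnW lt_w) ?sorted_w.
Qed.

Lemma size_pal_closure w b v : is_pal_closure (rcons w b) v ->
  size v <= (2 * size w).+1.
Proof.
case=> _ _ /(_ (rcons w b ++ rev w)); rewrite size_cat size_rcons size_rev.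
have -> : (size w).+1 + size w = (2 * size w).+1 by lia.
apply; last exact: prefix_prefix.
by rewrite /palindrome rev_cat revK rev_rcons cat_rcons.
Qed.

Lemma pal_closure_subseq w b v p : is_pal_closure (rcons w b) v ->
  palindrome p -> prefix (rcons w b) p -> subseq v p.
Proof.
move=> closure_v pal_p wb_p; have size_v := size_pal_closure closure_v.
have [pal_v wb_v min_v] := closure_v.
apply: (subseq_palindromes pal_v pal_p wb_v wb_p); last exact: min_v.
by rewrite size_rcons; lia.
Qed.

Lemma pal_closure_uniq w b v v' :
  is_pal_closure (rcons w b) v -> is_pal_closure (rcons w b) v' -> v = v'.
Proof.
move=> closure_v closure_v'; apply: subseq_anti.
have [pal_v wb_v _] := closure_v; have [pal_v' wb_v' _] := closure_v'.
by rewrite (pal_closure_subseq closure_v) // (pal_closure_subseq closure_v').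
Qed.

Lemma pal_closure_psi_pal_surj a w b p :
  is_pal_closure (rcons (psi_pal a w) b) p ->
  exists v, [/\ p = psi_pal a v, palindrome v & prefix (rcons w b) v].
Proof.
move=> closure_p; have size_p := size_pal_closure closure_p.
have [pal_p wb_p _] := closure_p.
have sep_p : separated a p.
  apply: sorted_palindrome wb_p _ _ => //.
  - by move=> c e; rewrite /= orbC.
  - by rewrite size_rcons; lia.
  - have := psi_pal_separated a (rcons w b).
    have := prefix_psi_pal a w b (rcons w b); rewrite prefix_refl.
    by case/prefixP=> z -> /cat_sorted2[].
have [q Ep] : exists q, p = a :: q.
  by case/prefixP: wb_p => z ->; rewrite psi_palE; eexists.
have last_p : last a p = a by rewrite -[p]pal_p Ep rev_cons last_rcons.
have [|||v Ev] := psi_pal_surj sep_p => //; try by rewrite Ep.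
exists v; split=> //; last by rewrite -(prefix_psi_pal a) -Ev.
by apply: (@psi_pal_inj _ a); rewrite psi_pal_rev -Ev.
Qed.

Lemma pal_closure_psi_pal a w b v : is_pal_closure (rcons w b) v ->
  is_pal_closure (rcons (psi_pal a w) b) (psi_pal a v).
Proof.
move=> closure_v; have [pal_v wb_v _] := closure_v.
have [p closure_p] := pal_closure_exists (rcons (psi_pal a w) b).
have [v' [Ep pal_v' wb_v']] := pal_closure_psi_pal_surj closure_p.
split; [by rewrite /palindrome -psi_pal_rev pal_v|by rewrite prefix_psi_pal|].
have [_ _ min_p] := closure_p => q pal_q wb_q.
apply: leq_trans (min_p q pal_q wb_q); rewrite Ep !size_rcons ltnS.
exact/size_subseq/psi_subseq/(pal_closure_subseq closure_v).
Qed.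

End Palindromes.

(** * Images of infinite words *)

Section Factors.

Variable T : eqType.
Implicit Types (t : nat -> T) (w : seq T).

Definition factor t i l : seq T := mkseq (fun z => t (i + z)) l.

Lemma factorD t i l l' :
  factor t i (l + l') = factor t i l ++ factor t (i + l) l'.
Proof.
rewrite /factor /mkseq iotaD map_cat -[0 + l]addn0 iotaDl -map_comp.
by congr (_ ++ _); apply: eq_map => z /=; rewrite addnA.
Qed.

Lemma factorS t i l : factor t i l.+1 = t i :: factor t i.+1 l.
Proof. by rewrite -add1n factorD addn1 /factor /= addn0. Qed.

Lemma factorSr t i l : factor t i l.+1 = rcons (factor t i l) (t (i + l)).
Proof. exact: mkseqS. Qed.

Lemma head_factor a t i l : head a (factor t i l.+1) = t i.
Proof. by rewrite factorS. Qed.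

Lemma last_factor a t i l : last a (factor t i l.+1) = t (i + l).
Proof. by rewrite factorSr last_rcons. Qed.

Lemma factor1 t i : factor t i 1 = [:: t i].
Proof. by rewrite factorS. Qed.

Lemma prefix_factor_le t i l l' :
  l <= l' -> prefix (factor t i l) (factor t i l').
Proof. by move/subnKC <-; rewrite factorD prefix_prefix. Qed.

Lemma prefix_factor_eq w t i l :
  prefix w (factor t i l) -> w = factor t i (size w).
Proof.
move=> pre_w; have := size_prefix pre_w; rewrite size_mkseq => le_w.
move: pre_w; rewrite prefixE -(subnKC le_w) factorD.
by rewrite take_size_cat ?size_mkseq // => /eqP.
Qed.

Lemma is_factor_power_repeat w l t : is_factor (wpow w l.+2) t ->
  exists i, factor t i (size w) = w /\ factor t (i + size w) (size w) = w.
Proof.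
case=> i Ew; exists i.
have : prefix (w ++ w) (factor t i (size (wpow w l.+2))).
  by rewrite -[factor _ _ _]Ew /wpow /= catA prefix_prefix.
move/prefix_factor_eq/eqP; rewrite size_cat factorD eqseq_cat ?size_mkseq //.
by case/andP=> /eqP<- /eqP<-.
Qed.

Definition left_maximal_repeat t i j l : Prop :=
  [/\ i < j, i = 0 \/ t i.-1 <> t j.-1 & factor t i l = factor t j l].

Lemma left_maximal_repeat_exists t i m l :
  0 < m -> factor t i l = factor t (i + m) l ->
  exists j l', l <= l' /\ left_maximal_repeat t j (j + m) l'.
Proof.
move=> m_gt0; elim: i l => [|i IHi] l eq_l.
  by exists 0, l; do 2!split=> //; left.
have [eq_i|/eqP neq_i] := eqVneq (t i) (t (i + m)).
  have [|j [l' [le_l rep]]] := IHi l.+1; first by rewrite !factorS eq_i eq_l.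
  by exists j, l'; split=> //; apply: ltnW.
by exists i.+1, l; do 2!split=> //; [lia|right].
Qed.

End Factors.

Section ReturnShape.

Variables (T : eqType) (c : T).

Variant return_shape (w : seq T) : Prop :=
| ReturnPower f of w = nseq f c
| ReturnLetter b of w = [:: b]
| ReturnLong of ~~ constant w & 2 < size w.

Lemma separated_return_shape w :
  separated c w -> (head c w == c) = (last c w == c) -> return_shape w.
Proof.
case: w => [|b [|e [|f w]]] sep_w ends.
- by apply: (@ReturnPower _ 0).
- exact: ReturnLetter.
- move: sep_w ends; rewrite /separated /= andbT.
  have [-> _ /esym/eqP->|_ /= ->] := eqVneq b c; last by [].
  by apply: (@ReturnPower _ 2).
have [/constantP|] := boolP (constant [:: b, e, f & w]); last first.
  by move=> nconst; apply: ReturnLong.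
move=> /(_ b)[g Ew]; apply: (@ReturnPower _ (size w).+3); rewrite Ew /=.
by case: Ew sep_w => -> -> _ _; rewrite /separated /= orbb => /andP[/eqP->].
Qed.

End ReturnShape.

Section Desubstitution.

Variable T : eqType.
Implicit Types (c : T) (t : nat -> T).

Definition psi_image c t' t : Prop := forall n,
  psi c (factor t' 0 n) = factor t 0 (size (psi c (factor t' 0 n))).

Lemma justin_formula (x : nat -> T) (u v : nat -> seq T) :
  u 0 = [::] -> (forall n, is_pal_closure (rcons (u n) (x n)) (u n.+1)) ->
  v 0 = [::] -> (forall n, is_pal_closure (rcons (v n) (x n.+1)) (v n.+1)) ->
  forall n, u n.+1 = psi_pal (x 0) (v n).
Proof.
move=> u0 uS v0 vS; elim=> [|n IHn].
  have := uS 0; rewrite u0 v0 => closure_x0.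
  apply: (@pal_closure_uniq _ [::] _ _ _ closure_x0).
  by split=> //; [exact: prefix_refl|move=> p _ /size_prefix].
apply: (@pal_closure_uniq _ (psi_pal (x 0) (v n)) (x n.+1)).
  by rewrite -IHn.
exact: pal_closure_psi_pal.
Qed.

Lemma standard_episturmian_desubstitute (x t : nat -> T) :
  standard_episturmian x t ->
  exists2 t', standard_episturmian (fun n => x n.+1) t' & psi_image (x 0) t' t.
Proof.
case=> u [u0 uS u_prefix _].
have [t' et'] := standard_episturmian_exists (fun n => x n.+1).
exists t' => // n; case: et' => v [v0 vS _ v_lim].
have [n0 /(_ n0 (leqnn n0))[_ take_v]] := v_lim n.
have uv := justin_formula u0 uS v0 vS n0.
have [_ u_mkseq] := u_prefix n0.+1.
apply: (@prefix_factor_eq _ _ t 0 (size (u n0.+1))).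
rewrite -[factor t 0 _]u_mkseq uv -(cat_take_drop n (v n0)) take_v.
by rewrite psi_pal_cat prefix_prefix.
Qed.

Variables (c : T) (t' t : nat -> T).
Hypothesis tP : psi_image c t' t.

Definition psi_pos (i : nat) : nat := size (psi c (factor t' 0 i)).

Lemma psi_posD i l :
  psi_pos (i + l) = psi_pos i + size (psi c (factor t' i l)).
Proof. by rewrite /psi_pos factorD psi_cat size_cat. Qed.

Lemma psi_posS i : psi_pos i.+1 = psi_pos i + (t' i != c).+1.
Proof. by rewrite -addn1 psi_posD factor1 psi_cons; case: eqP. Qed.

Lemma psi_image_factor i l :
  factor t (psi_pos i) (size (psi c (factor t' i l))) = psi c (factor t' i l).
Proof.
have := tP (i + l); rewrite -/(psi_pos _) psi_posD factorD psi_cat factorD.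
by rewrite -tP => /eqP; rewrite eqseq_cat // eqxx => /eqP.
Qed.

Lemma psi_image_pos i : t (psi_pos i) = c.
Proof.
have := psi_image_factor i 1; rewrite factor1 psi_cons.
by case: eqP => _; rewrite factorS => -[].
Qed.

Lemma psi_image_psi_pal i l :
  factor t (psi_pos i) (size (psi c (factor t' i l))).+1 =
  psi_pal c (factor t' i l).
Proof.
by rewrite factorSr psi_image_factor -psi_posD psi_image_pos.
Qed.

Lemma psi_image_posS i : t (psi_pos i).+1 = t' i.
Proof.
have := psi_image_psi_pal i 1; rewrite factor1 psi_pal_cons psi_cons.
by case: eqP => [->|_]; rewrite !factorS => -[].
Qed.

Lemma psi_pos_cover j :
  (exists i, j = psi_pos i) \/ (exists2 i, t' i != c & j = (psi_pos i).+1).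
Proof.
elim: j => [|j [[i ->]|[i nc ->]]]; first by left; exists 0.
  have [t'i|nc] := eqVneq (t' i) c; last by right; exists i.
  by left; exists i.+1; rewrite psi_posS t'i eqxx addn1.
by left; exists i.+1; rewrite psi_posS nc addn2.
Qed.

Lemma psi_image_block j : t j = c -> exists i, j = psi_pos i.
Proof.
case: (psi_pos_cover j) => // -[i /eqP nc ->].
by rewrite psi_image_posS.
Qed.

Lemma psi_image_isolated j : (t j == c) || (t j.+1 == c).
Proof.
case: (psi_pos_cover j) => -[i]; first by move->; rewrite psi_image_pos eqxx.
move=> nc ->; have := psi_image_pos i.+1.
by rewrite psi_posS nc addn2 => ->; rewrite eqxx orbT.
Qed.

Lemma psi_image_separated i l : separated c (factor t i l).
Proof.
elim: l i => // -[|l] IHl i; first by rewrite factor1.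
have := IHl i.+1; rewrite !factorS /separated /= => ->.
by rewrite psi_image_isolated.
Qed.

Lemma psi_image_pos_pred i : t (psi_pos i.+1).-1 = t' i.
Proof.
rewrite psi_posS addnS /=; have [->|nc] := eqVneq (t' i) c.
  by rewrite addn0 psi_image_pos.
by rewrite addn1 psi_image_posS.
Qed.

Lemma psi_pos_mono : {mono psi_pos : i j / i < j}.
Proof.
apply/leqW_mono/leq_mono; apply: homo_ltn => [|i]; first exact: ltn_trans.
by rewrite psi_posS addnS ltnS leq_addr.
Qed.

Lemma psi_image_factor_eq i j l :
  factor t (psi_pos i) l = factor t (psi_pos j) l ->
  exists2 e, factor t' i e = factor t' j e &
    prefix (factor t (psi_pos i) l) (psi_pal c (factor t' i e)).
Proof.
elim: l => [|l IHl]; first by exists 0; rewrite ?prefix0s.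
rewrite [X in X = _]factorSr [X in _ = X]factorSr => /rcons_inj[eq_l eq_last].
have [e eq_e /size_prefix] := IHl eq_l.
rewrite size_mkseq size_rcons leq_eqVlt => /predU1P[El|lt_l]; last first.
  by exists e => //; rewrite -psi_image_psi_pal prefix_factor_le.
have t'_e h : factor t' i e = factor t' h e -> t (psi_pos h + l) = t' (h + e).
  by move=> eq_h; rewrite El eq_h addnS -psi_posD psi_image_posS.
exists e.+1; first by rewrite !factorSr -!t'_e ?eq_e ?eq_last.
rewrite -psi_image_psi_pal prefix_factor_le // El ltnS.
rewrite factorSr -cats1 psi_cat size_cat psi_cons.
by case: eqP => _ /=; lia.
Qed.

Lemma left_maximal_repeat_desubstitute i j l :
  left_maximal_repeat t i j l -> t i = t j ->
  exists i' j' l', [/\ left_maximal_repeat t' i' j' l',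
    factor t i (j - i) = psi c (factor t' i' (j' - i')) &
    prefix (factor t i l) (psi_pal c (factor t' i' l'))].
Proof.
case=> lt_ij left_max eq_l eq_ij.
have ti : t i = c.
  case: (i) (j) lt_ij left_max eq_ij => [|h] [|h'] //= _.
    by move=> _ _; apply: psi_image_pos 0.
  case=> // neq_h eq_hh'; apply/eqP/contraT => ntc; case: neq_h.
  have := psi_image_isolated h; have := psi_image_isolated h'.
  by rewrite -eq_hh' (negbTE ntc) !orbF => /eqP-> /eqP->.
have [i' Ei] := psi_image_block ti; rewrite eq_ij in ti.
have [j' Ej] := psi_image_block ti; subst i j.
rewrite psi_pos_mono in lt_ij.
have [l' eq_l' pre_l] := psi_image_factor_eq eq_l.
exists i', j', l'; split=> //; last first.
  rewrite -psi_image_factor; congr factor.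
  by rewrite -{1}(subnKC (ltnW lt_ij)) psi_posD addKn.
split=> //; case: (i') (j') lt_ij left_max => [|h] [|h'] // _; first by left.
by case=> [|]; rewrite ?psi_image_pos_pred; [rewrite psi_posS addnS|right].
Qed.

Lemma left_maximal_repeat_return_shape i j l :
  left_maximal_repeat t i j l -> t i <> t j ->
  return_shape c (factor t i (j - i)).
Proof.
case=> lt_ij left_max _ /eqP neq_ij.
apply: separated_return_shape; first exact: psi_image_separated.
case: j lt_ij left_max neq_ij => // j lt_ij left_max neq_ij.
rewrite subSn // head_factor last_factor subnKC //.
have := psi_image_isolated j; have [<-|nti _] := eqVneq (t i) c.
  by rewrite ![_ == t i]eq_sym (negbTE neq_ij) orbF => ->.
case: i lt_ij left_max nti {neq_ij} => [|i] _ left_max nti.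
  by have := psi_image_pos 0; rewrite /psi_pos /= => t0; rewrite t0 eqxx in nti.
case: left_max => // /eqP; have := psi_image_isolated i.
by rewrite (negbTE nti) orbF => /eqP->; rewrite eq_sym => /negbTE->.
Qed.

End Desubstitution.

Section IteratedPsi.

Variables (T : eqType) (x : nat -> T).
Implicit Types (v w : seq T).

Fixpoint psis J w : seq T := if J is J'.+1 then psis J' (psi (x J') w) else w.

(* [psi_pals J [::]] is the palindromic prefix u_J. *)
Fixpoint psi_pals J w : seq T :=
  if J is J'.+1 then psi_pals J' (psi_pal (x J') w) else w.

Lemma psis_cat J v w : psis J (v ++ w) = psis J v ++ psis J w.
Proof. by elim: J v w => //= J IHJ v w; rewrite psi_cat IHJ. Qed.

Lemma psis_subseq J v w : subseq v w -> subseq (psis J v) (psis J w).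
Proof. by elim: J v w => //= J IHJ v w sub_vw; apply/IHJ/psi_subseq. Qed.

Lemma psis1S J b :
  psis J.+1 [:: b] =
  (if b == x J then [::] else psis J [:: x J]) ++ psis J [:: b].
Proof. by rewrite /= psi_cons; case: eqP => [->|_]; rewrite -?psis_cat. Qed.

Lemma size_psis_le J J' w : J <= J' -> size (psis J w) <= size (psis J' w).
Proof.
move/subnKC <-; elim: (J' - J) => [|l IHl]; rewrite ?addn0 // addnS.
exact/(leq_trans IHl)/size_subseq/psis_subseq/subseq_psi.
Qed.

Lemma psi_palsE J w : psi_pals J w = psis J w ++ psi_pals J [::].
Proof.
elim: J w => [|J IHJ] w /=; first by rewrite cats0.
by rewrite IHJ [psi_pals J (psi_pal _ [::])]IHJ catA -psis_cat cats1.
Qed.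

Lemma size_psi_pals_subseq J v w : subseq v w ->
  size (psi_pals J v) <= size (psi_pals J w).
Proof.
move=> sub_vw; rewrite psi_palsE [psi_pals J w]psi_palsE !size_cat leq_add2r.
exact/size_subseq/psis_subseq.
Qed.

(* [B] bounds the number of desubstitutions: the distance is a sum of lengths
   |Psi_J(b)|, which are nondecreasing in J and exceed it once J >= B. *)
Lemma repeat_return_shape B J t i j l :
  standard_episturmian (fun n => x (J + n)) t -> left_maximal_repeat t i j l ->
  (forall b, size (psis J (factor t i (j - i))) < size (psis B [:: b])) ->
  size (psis J (factor t i (j - i))) <= size (psi_pals J (factor t i l)) ->
  exists J' w, [/\ return_shape (x J') w,
    size (psis J' w) = size (psis J (factor t i (j - i))) &
    size (psis J' w) <= size (psi_pals J' [::])].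
Proof.
have [n] := ubnP (B - J); elim: n J t i j l => // n IHn J t i j l le_n et rep.
move=> lt_m le_m; have lt_J : J < B.
  rewrite ltnNge; apply/negP => le_B; have := lt_m (t i).
  rewrite ltnNge (leq_trans (size_psis_le _ le_B)) //.
  apply/size_subseq/psis_subseq; rewrite sub1seq.
  by have [lt_ij _ _] := rep; rewrite -(subnSK lt_ij) factorS mem_head.
have [t' et' tP] := standard_episturmian_desubstitute et; rewrite addn0 in tP.
have [eq_ij|neq_ij] := eqVneq (t i) (t j); last first.
  exists J, (factor t i (j - i)); split=> //.
    exact: (left_maximal_repeat_return_shape tP rep (elimN eqP neq_ij)).
  case: l rep le_m => // l [_ _].
  by rewrite !factorS => -[eq_ij]; rewrite eq_ij eqxx in neq_ij.
have [i' [j' [l' [rep' Ew pre_l]]]] :=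
  left_maximal_repeat_desubstitute tP rep eq_ij.
rewrite Ew in lt_m le_m *; apply: (IHn J.+1 t' i' j' l') => //; first lia.
  have -> // : (fun n => x (J.+1 + n)) = (fun n => x (J + n.+1)).
  by apply/boolp.funext => z; rewrite addnS.
apply: leq_trans le_m _; apply: size_psi_pals_subseq; exact/infixW/prefixW.
Qed.

Lemma power_return_shape B t w l :
  standard_episturmian x t -> is_factor (wpow w l.+2) t -> 0 < size w ->
  (forall b, size w < size (psis B [:: b])) ->
  exists J v, [/\ return_shape (x J) v, size (psis J v) = size w &
    size w <= size (psi_pals J [::])].
Proof.
move=> et /is_factor_power_repeat[i [factor_i factor_iw]] w_gt0 lt_B.
have [|j [e [le_e rep]]] := @left_maximal_repeat_exists _ t i _ (size w) w_gt0.
  by rewrite factor_i factor_iw.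
have [||J [v]] := @repeat_return_shape B 0 t _ _ _ et rep.
- by rewrite /= size_mkseq addKn.
- by rewrite /= !size_mkseq addKn.
by rewrite /= size_mkseq addKn => -[shape_v Ev]; rewrite Ev; exists J, v.
Qed.

Lemma size_psis J w : size (psis J w) = \sum_(b <- w) size (psis J [:: b]).
Proof.
elim: w => [|b w IHw]; last by rewrite big_cons -IHw -cat1s psis_cat size_cat.
by rewrite big_nil; elim: J => //= J ->.
Qed.

Lemma psis_run_self J q c : (forall p, p < q -> x (J + p) = c) ->
  psis (J + q) [:: c] = psis J [:: c].
Proof.
elim: q => [|q IHq] run; first by rewrite addn0.
by rewrite addnS psis1S run // eqxx IHq // => p /ltnW/run.
Qed.

Lemma psis_run J q c b : (forall p, p < q -> x (J + p) = c) -> b != c ->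
  psis (J + q) [:: b] = wpow (psis J [:: c]) q ++ psis J [:: b].
Proof.
move=> run nbc; elim: q run => [|q IHq] run; first by rewrite addn0.
have run_q p : p < q -> x (J + p) = c by move/ltnW/run.
rewrite addnS psis1S run // (negbTE nbc) psis_run_self // IHq //.
by rewrite /wpow /= catA.
Qed.

Lemma psi_pals_run J q c : (forall p, p < q -> x (J + p) = c) ->
  psi_pals (J + q) [::] = wpow (psis J [:: c]) q ++ psi_pals J [::].
Proof.
elim: q => [|q IHq] run; first by rewrite addn0.
have run_q p : p < q -> x (J + p) = c by move/ltnW/run.
rewrite addnS /= psi_palsE -[psi_pal _ _]/[:: x (J + q)] run //.
by rewrite psis_run_self // IHq // /wpow /= catA.
Qed.

End IteratedPsi.

(** * The words s_n *)

Section DirectiveBlocks.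

Variable d : nat -> nat.

Definition block_start (n : nat) : nat := \sum_(1 <= j < n.+1) d j.

Lemma block_startS n : block_start n.+1 = block_start n + d n.+1.
Proof. by rewrite /block_start big_nat_recr. Qed.

Hypothesis d_gt0 : forall j, 1 <= j -> 1 <= d j.

Lemma leq_block_start n : n <= block_start n.
Proof.
by elim: n => // n IHn; rewrite block_startS; have := d_gt0 (ltn0Sn n); lia.
Qed.

Lemma block_start_cover J : exists n q, q < d n.+1 /\ J = block_start n + q.
Proof.
elim: J => [|J [n [q [lt_q ->]]]].
  by exists 0, 0; rewrite /block_start big_geq // d_gt0.
have [lt_qS|le_d] := ltnP q.+1 (d n.+1); first by exists n, q.+1; rewrite addnS.
by exists n.+1, 0; rewrite d_gt0 // block_startS; split=> //; lia.
Qed.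

End DirectiveBlocks.

Lemma size_wpow (T : Type) (w : seq T) l : size (wpow w l) = l * size w.
Proof.
by rewrite /wpow; elim: l => // l IHl; rewrite /= size_cat IHl mulSn.
Qed.

Section StandardWords.

Variables (k : nat) (hk : 1 < k) (d : nat -> nat).
Hypothesis d_gt0 : forall j, 1 <= j -> 1 <= d j.

Implicit Types (n i q e m p r : nat) (b : 'I_k).

Local Notation letter := (letter hk).
Local Notation sword := (sword hk d).
Local Notation sprod := (sprod hk d).
Local Notation x := (directive hk d).

(* s_(n-1)^(d_n) ... s_(n-i+1)^(d_(n-i+2)) s_(n-i) *)
Definition sprod_tail (n i : nat) : seq 'I_k :=
  sprod n i.-1 ++ sword (n%:Z - i%:Z)%R.

Lemma sprodS n c : sprod n.+1 c.+1 = wpow (sword n) (d n.+1) ++ sprod n c.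
Proof.
rewrite /Defs.sprod /= addn1 subn1; congr (_ ++ _).
rewrite -[2]/(1 + 1) iotaDl -map_comp; congr flatten.
by apply: eq_map => j /=; congr (wpow (Defs.sword _ _ _) (dz _ _)); lia.
Qed.

Lemma sprod0 c : sprod 0 c = [::].
Proof.
rewrite /Defs.sprod -[1]addn0 iotaDl -map_comp.
elim: (iota 0 c) => // j l IHl; rewrite /= IHl cats0.
by case E: (_ + _ - _)%R => [[|z]|z] //=; lia.
Qed.

Lemma sprod_saturated n i : n <= i -> sprod n i = sprod n n.
Proof.
by elim: n i => [|n IHn] [|i] //= le_ni; rewrite ?sprod0 // !sprodS IHn.
Qed.

Lemma sprod_tail0 i : 0 < i -> sprod_tail 0 i = [:: letter (k - i)].
Proof.
case: i => // i _; rewrite /sprod_tail sprod0.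
by have -> : (0%:Z - i.+1%:Z = Negz i)%R by lia.
Qed.

Lemma sprod_tailS1 n : sprod_tail n.+1 1 = sword n.
Proof. by rewrite /sprod_tail; have -> : (n.+1%:Z - 1%:Z = n%:Z)%R by lia. Qed.

Lemma sprod_tailSS n i : 0 < i ->
  sprod_tail n.+1 i.+1 = wpow (sword n) (d n.+1) ++ sprod_tail n i.
Proof.
case: i => // i _; rewrite /sprod_tail /= sprodS -catA.
by congr (_ ++ (_ ++ Defs.sword _ _ _)); lia.
Qed.

Lemma sword_sprod_tail n : sword n = sprod_tail n k.
Proof.
rewrite /sprod_tail -subn1; have [lt_nk|le_kn] := ltnP n k; last first.
  exact: sword_large.
case: n lt_nk => [_|n lt_nk].
  by rewrite subn1 -/(sprod_tail 0 k) sprod_tail0 ?subnn // ltnW.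
rewrite sprod_saturated ?sword_neg ?sword_small //; lia.
Qed.

Lemma directive_block n q : q < d n.+1 -> x (block_start d n + q) = letter n.
Proof.
move=> lt_q; rewrite /directive.
have -> : (block_start d n + q).+1 = n + (block_start d n + q - n).+1.
  by have := leq_block_start d_gt0 n; lia.
rewrite iotaD map_cat flatten_cat nth_cat.
have -> : size (flatten [seq nseq (d j) (letter j.-1) | j <- iota 1 n]) =
    block_start d n.
  rewrite size_flatten /shape -map_comp sumnE big_map /block_start /index_iota.
  by rewrite subSS subn0; apply: eq_bigr => j _ /=; rewrite size_nseq.
by rewrite ltnNge leq_addr /= addKn add1n nth_cat size_nseq lt_q nth_nseq lt_q.
Qed.

Lemma letter_eq n e : e < k -> (letter (n + e) == letter n) = (e == 0).
Proof.
by move=> lt_e; rewrite -val_eqE /= -{2}[n]addn0 eqn_modDl mod0n modn_small.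
Qed.

Lemma letter_surj n b : exists2 e, e < k & b = letter (n + e).
Proof.
exists ((b + k.-1 * n) %% k); first by rewrite ltn_mod ltnW.
apply: val_inj; rewrite /= modnDmr addnCA -mulSn prednK 1?ltnW //.
by rewrite addnC mulnC modnMDl modn_small.
Qed.

Lemma letterDk n : letter (n + k) = letter n.
Proof. by apply: val_inj; rewrite /= modnDr. Qed.

Lemma psis_block_start n e : e < k ->
  psis x (block_start d n) [:: letter (n + e)] = sprod_tail n (k - e).
Proof.
elim: n e => [|n IHn] e lt_e.
  rewrite sprod_tail0 ?subn_gt0 // subKn ?(ltnW lt_e) //.
  by rewrite /block_start big_geq.
have psis_n : psis x (block_start d n) [:: letter n] = sword n.
  by rewrite -[n in letter n]addn0 IHn ?subn0 -?sword_sprod_tail // ltnW.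
rewrite block_startS addSnnS; have [lt_eS|le_k] := ltnP e.+1 k.
  rewrite (psis_run (@directive_block n)) ?letter_eq // psis_n IHn //.
  by rewrite -(subnSK lt_e) sprod_tailSS // subn_gt0.
have -> : e.+1 = k by apply/eqP; rewrite eqn_leq le_k andbT.
have -> : k - e = 1 by lia.
by rewrite letterDk (psis_run_self (@directive_block n)) psis_n sprod_tailS1.
Qed.

Lemma psis_block_start_self n :
  psis x (block_start d n) [:: letter n] = sword n.
Proof.
rewrite -[n in letter n]addn0 psis_block_start ?(ltnW hk) //.
by rewrite subn0 -sword_sprod_tail.
Qed.

Section InBlock.

Variables (n q : nat).
Hypothesis le_q : q <= d n.+1.

Let x_block p : p < q -> x (block_start d n + p) = letter n.
Proof. by move=> lt_p; apply/directive_block/(leq_trans lt_p). Qed.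

Lemma psis_block_self : psis x (block_start d n + q) [:: letter n] = sword n.
Proof. by rewrite (psis_run_self x_block) psis_block_start_self. Qed.

Lemma psis_block_other e : 0 < e < k ->
  psis x (block_start d n + q) [:: letter (n + e)] =
  wpow (sword n) q ++ sprod_tail n (k - e).
Proof.
case/andP=> e_gt0 lt_e; rewrite (psis_run x_block) ?letter_eq -?lt0n //.
by rewrite psis_block_start_self psis_block_start.
Qed.

Lemma psi_pals_block :
  psi_pals x (block_start d n + q) [::] =
  wpow (sword n) q ++ psi_pals x (block_start d n) [::].
Proof. by rewrite (psi_pals_run x_block) psis_block_start_self. Qed.

End InBlock.

Lemma psi_pals_block_start n : psi_pals x (block_start d n) [::] = sprod n n.
Proof.
elim: n => [|n IHn]; first by rewrite sprod0 /block_start big_geq.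
by rewrite block_startS psi_pals_block // IHn sprodS.
Qed.

Local Notation slen n := (size (sword (Posz n))).

Lemma size_sprod_tailSS n i : 0 < i ->
  size (sprod_tail n.+1 i.+1) = d n.+1 * slen n + size (sprod_tail n i).
Proof. by move=> i_gt0; rewrite sprod_tailSS // size_cat size_wpow. Qed.

Lemma size_swordS n :
  slen n.+1 = d n.+1 * slen n + size (sprod_tail n k.-1).
Proof.
rewrite sword_sprod_tail -[X in sprod_tail _ X](ltn_predK hk).
by rewrite size_sprod_tailSS //; lia.
Qed.

Lemma size_sprod_tail_le n i j : 0 < i <= j ->
  size (sprod_tail n i) <= size (sprod_tail n j).
Proof.
elim: n i j => [|n IHn] i j /andP[i_gt0 le_ij].
  by rewrite !sprod_tail0 // (leq_trans i_gt0).
case: i j i_gt0 le_ij => [|[|i]] // [|[|j]] // _ le_ij.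
  rewrite sprod_tailS1 size_sprod_tailSS // (leq_trans _ (leq_addr _ _)) //.
  by rewrite leq_pmull // d_gt0.
by rewrite !size_sprod_tailSS // leq_add2l IHn.
Qed.

Lemma size_sprod_tail_gt0 n i : 0 < i -> 0 < size (sprod_tail n i).
Proof.
elim: n i => [|n IHn] i i_gt0; first by rewrite sprod_tail0.
apply: (@leq_trans (size (sprod_tail n.+1 1))).
  by rewrite sprod_tailS1 sword_sprod_tail IHn // ltnW.
by rewrite size_sprod_tail_le.
Qed.

Lemma size_sword_lt n : slen n < slen n.+1.
Proof.
rewrite size_swordS -addn1 leq_add //; first by rewrite leq_pmull // d_gt0.
by rewrite size_sprod_tail_gt0 //; lia.
Qed.

Lemma size_sword_le : {homo (fun n => slen n) : m n / m <= n}.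
Proof.
by apply: homo_leq => // [|n]; [exact: leq_trans|exact/ltnW/size_sword_lt].
Qed.

Lemma size_sword_gt n : n < slen n.
Proof. by elim: n => // n IHn; apply: leq_ltn_trans IHn (size_sword_lt n). Qed.

Lemma size_sprod_tail_ge n i : 0 < i -> slen n <= size (sprod_tail n.+1 i).
Proof. by move=> i_gt0; rewrite -sprod_tailS1 size_sprod_tail_le. Qed.

(* The bound 2 |s_n| needed below is not preserved by the induction when
   d_(n+1) = 1; the second summand is |s_(n-1)| for n > 0. *)
Lemma size_sprod_lt n : size (sprod n n) < slen n + size (sprod_tail n 1).
Proof.
elim: n => [|n IHn]; first by rewrite sprod0 addn_gt0 size_sword_gt.
rewrite sprodS sprod_tailS1 size_swordS size_cat size_wpow -addnA ltn_add2l.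
apply: leq_trans IHn _; rewrite addnC leq_add2r size_sprod_tail_le //.
by lia.
Qed.

Lemma size_psi_pals_block_lt n q : q <= d n.+1 ->
  size (psi_pals x (block_start d n + q) [::]) < q.+2 * slen n.
Proof.
move=> le_q; rewrite psi_pals_block // psi_pals_block_start.
rewrite size_cat size_wpow -addn2 mulnDl ltn_add2l mul2n -addnn.
apply: leq_trans (size_sprod_lt n) _; rewrite leq_add2l.
by rewrite [sword n]sword_sprod_tail size_sprod_tail_le //; lia.
Qed.

Lemma mem_Dset1 n r : 0 < r <= d n.+1 -> r * slen n \in Dset hk d 1 n.
Proof.
move=> bounds_r; rewrite /Dset /=; apply/mapP; exists r => //.
by rewrite mem_iota add1n ltnS.
Qed.

Lemma mem_Dset1_size_sword n : slen n \in Dset hk d 1 n.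
Proof. by rewrite -[slen n]mul1n mem_Dset1 // d_gt0. Qed.

Lemma DsetS n i : 0 < i -> Dset hk d i.+1 n =
  [seq r * slen n + size (sprod_tail n i) |
    r <- iota 1 (if i.+1 < k then d n.+1 else d n.+1 - 1)].
Proof.
case: i => // i _; rewrite /Dset eqSS /= fun_if.
have word_length r : size (wpow (sword n) r ++ sprod n (i.+2 - 2) ++
    sword (n%:Z + 1 - i.+2%:Z)%R) = r * slen n + size (sprod_tail n i.+1).
  rewrite size_cat size_wpow subn2 /sprod_tail.
  by congr (_ + size (_ ++ Defs.sword _ _ _)); lia.
by case: ifP => _; apply: eq_map.
Qed.

Lemma mem_Dset_bounds m n i : 0 < i <= k -> m \in Dset hk d i n ->
  slen n <= m <= slen n.+1.
Proof.
case: i => // -[_|i le_ik] /=.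
  case/mapP=> r; rewrite mem_iota add1n ltnS => /andP[r_gt0 le_r] ->.
  rewrite leq_pmull //= size_swordS (leq_trans _ (leq_addr _ _)) //.
  by rewrite leq_mul2r le_r orbT.
rewrite DsetS // => /mapP[r]; rewrite mem_iota => /andP[r_gt0 lt_r] ->.
rewrite (leq_trans _ (leq_addr _ _)) ?leq_pmull //= size_swordS leq_add //.
  by rewrite leq_mul2r; case: ifP lt_r => _ lt_r; lia.
by rewrite size_sprod_tail_le //; lia.
Qed.

Definition in_Dsets (m : nat) : Prop :=
  exists n i, 0 < i <= k /\ m \in Dset hk d i n.

Lemma in_Dsets_between m n : in_Dsets m -> slen n <= m < slen n.+1 ->
  exists2 i, 0 < i <= k & m \in Dset hk d i n.
Proof.
case=> n' [i [le_i m_in]] /andP[le_nm lt_mn].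
have /andP[le_n'm le_mn'] := mem_Dset_bounds le_i m_in.
have slen_lt_le p r : slen p < slen r.+1 -> p <= r.
  by rewrite [p <= r]leqNgt; apply: contraL => /size_sword_le; rewrite -leqNgt.
have le_n'n : n' <= n by apply: slen_lt_le; apply: leq_ltn_trans lt_mn.
have := le_nm; rewrite leq_eqVlt => /predU1P[<-|lt_nm].
  by exists 1; [lia|exact: mem_Dset1_size_sword].
have le_nn' : n <= n' by apply: slen_lt_le; apply: leq_trans le_mn'.
by exists i => //; have <- : n' = n by apply/eqP; rewrite eqn_leq le_n'n.
Qed.

Section Periods.

Variables (n q : nat).
Hypothesis lt_q : q < d n.+1.

Local Notation J := (block_start d n + q.+1).

Lemma size_psis_letter_in_Dsets b : in_Dsets (size (psis x J [:: b])).
Proof.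
have [[|e] lt_e ->] := letter_surj n b.
  rewrite addn0 psis_block_self //; exists n, 1.
  by rewrite mem_Dset1_size_sword; split=> //; lia.
rewrite psis_block_other // size_cat size_wpow.
have [block_end|in_block] := boolP ((e == 0) && (q.+1 == d n.+1)).
  case/andP: block_end => /eqP-> /eqP->; exists n.+1, 1.
  by rewrite subn1 -size_swordS mem_Dset1_size_sword; split=> //; lia.
exists n, (k - e); split; first lia.
rewrite -(subnSK (ltnW lt_e)) DsetS ?subn_gt0 //; apply: map_f.
by rewrite mem_iota; case: ifP; lia.
Qed.

Lemma size_psis_letter_ge b : slen n <= size (psis x J [:: b]).
Proof.
have [[|e] lt_e ->] := letter_surj n b; first by rewrite addn0 psis_block_self.
rewrite psis_block_other // size_cat size_wpow mulSn -addnA; exact: leq_addr.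
Qed.

Lemma size_psis_other_ge b :
  b != letter n -> q.+1 * slen n <= size (psis x J [:: b]).
Proof.
have [e lt_e ->] := letter_surj n b; rewrite letter_eq // -lt0n => e_gt0.
by rewrite psis_block_other ?e_gt0 // size_cat size_wpow leq_addr.
Qed.

Lemma size_psis_long w : ~~ constant w -> 2 < size w ->
  q.+3 * slen n <= size (psis x J w).
Proof.
move=> nconst_w gt2_w.
have /allPn[b b_w nb] : ~~ all (pred1 (letter n)) w.
  by apply: contra nconst_w; apply: all_pred1_constant.
rewrite size_psis (big_rem b) //= -addn2 mulnDl leq_add //.
  exact: size_psis_other_ge.
apply: (@leq_trans (size (rem b w) * slen n)).
  by rewrite leq_mul2r size_rem //; lia.
rewrite -[size _]sum1_size big_distrl /=; apply: leq_sum => c _.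
by rewrite mul1n size_psis_letter_ge.
Qed.

End Periods.

Lemma return_power_in_Dsets J f :
  0 < size (psis x J (nseq f (x J))) <= size (psi_pals x J [::]) ->
  in_Dsets (size (psis x J (nseq f (x J)))).
Proof.
have [n [q [lt_q EJ]]] := block_start_cover d_gt0 J.
have -> : size (psis x J (nseq f (x J))) = f * slen n.
  rewrite size_psis big_nseq iter_addn_0 EJ directive_block //.
  by rewrite psis_block_self 1?ltnW // mulnC.
rewrite muln_gt0 => /andP[/andP[f_gt0 slen_gt0] le_pal]; exists n, 1.
split; first lia; apply: mem_Dset1; rewrite f_gt0.
apply: (leq_trans _ lt_q); rewrite -ltnS -(ltn_pmul2r slen_gt0).
apply: leq_ltn_trans le_pal _; rewrite EJ.
exact/size_psi_pals_block_lt/ltnW.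
Qed.

Lemma return_shape_in_Dsets J w : return_shape (x J) w ->
  0 < size (psis x J w) <= size (psi_pals x J [::]) ->
  in_Dsets (size (psis x J w)).
Proof.
move=> shape_w bounds_w; case: shape_w bounds_w => [f ->|b ->|nconst_w gt2_w].
- exact: return_power_in_Dsets.
- case/andP=> gt0_b le_pal; case: J gt0_b le_pal => // J _ _.
  have [n [q [lt_q ->]]] := block_start_cover d_gt0 J.
  by rewrite -addnS; apply: size_psis_letter_in_Dsets.
case/andP=> gt0_w le_pal; case: J gt0_w le_pal => [|J] gt0_w.
  by rewrite leqNgt gt0_w.
have [n [q [lt_q ->]]] := block_start_cover d_gt0 J; rewrite -addnS => le_pal.
have := leq_trans (size_psis_long lt_q nconst_w gt2_w) le_pal.
by rewrite leqNgt size_psi_pals_block_lt.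
Qed.

Lemma power_size_in_Dsets s w l :
  standard_episturmian x s -> is_factor (wpow w l.+2) s -> 0 < size w ->
  in_Dsets (size w).
Proof.
move=> es w_power w_gt0; pose B := block_start d (size w).+1.
have lt_B b : size w < size (psis x B [:: b]).
  have [e lt_e ->] := letter_surj (size w).+1 b; rewrite psis_block_start //.
  by apply/(leq_trans (size_sword_gt _))/size_sprod_tail_ge; rewrite subn_gt0.
have [J [v [shape_v Ev le_pal]]] := power_return_shape es w_power w_gt0 lt_B.
by rewrite -Ev; apply: return_shape_in_Dsets; rewrite ?Ev ?w_gt0.
Qed.

End StandardWords.

Theorem theorem6p1 (k : nat) (hk : 1 < k) (d : nat -> nat)
  (hd : forall j : nat, 1 <= j -> 1 <= d j)
  (s : nat -> 'I_k) (hs : standard_episturmian (directive hk d) s)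
  (m n : nat) (hm : 1 <= m) (hn : 1 <= n)
  (hmn : size (sword hk d n) <= m < size (sword hk d n.+1))
  (hD : forall i : nat, 1 <= i <= k -> m \notin Dset hk d i n) :
  forall l : nat, 2 <= l -> num_powers s m l = 0.
Proof.
case=> [|[|l]] // _; apply/eqP; rewrite cards_eq0 -subset0; apply/subsetP => w.
rewrite inE => /boolp.asboolP w_power.
have := power_size_in_Dsets hd hs w_power; rewrite size_tuple => /(_ hm) m_in.
have [i le_i] := in_Dsets_between hd m_in hmn.
by rewrite (negbTE (hD i le_i)).
Qed.
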